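(* Let $\alpha\in[0,1)$ and let $G$ be a strongly connected digraph with $n$ vertices and $m$ arcs, maximum outdegree $\Delta^+$, maximum indegree $\Delta^-$ and minimum outdegree $\delta^+$. Then $$\lambda_\alpha(G)\leq \alpha\Delta^{+}+(1-\alpha)\sqrt{m-\delta^+(n-\Delta^-)},$$ and equality holds if and only if $G$ is a regular digraph.
   Context: Digraphs are finite, have no loops and no two arcs with the same tail and the same head (pairs of opposite arcs $(v_i,v_j),(v_j,v_i)$ are allowed). For a digraph $G$ with vertices $v_1,\dots,v_n$, $A(G)=(a_{ij})$ is the adjacency matrix ($a_{ij}=1$ if $(v_i,v_j)$ is an arc, $0$ otherwise), $d_i^+$ is the outdegree of $v_i$, $d_i^-$ its indegree, and $D(G)=\mathrm{diag}(d_1^+,\dots,d_n^+)$. The $A_\alpha$ matrix is $A_\alpha(G)=\alpha D(G)+(1-\alpha)A(G)$, and $\lambda_\alpha(G)$ denotes the eigenvalue of $A_\alpha(G)$ of largest modulus (for strongly connected $G$ this is the Perron root). A digraph is strongly connected if there is a directed path from every vertex to every other vertex. A digraph is regular if, for some $k$, every vertex has outdegree $k$ and indegree $k$. *)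

(* Defs.v *)
From mathcomp Require Import all_boot all_order all_algebra.
From mathcomp Require Import complex.
From mathcomp Require Import boolp classical_sets reals.
Set Implicit Arguments.
Unset Strict Implicit.
Unset Printing Implicit Defensive.
Import Order.TTheory GRing.Theory Num.Theory.
Local Open Scope ring_scope.
Local Open Scope complex_scope.

Record digraph (n : nat) := Digraph {
  arc :> rel 'I_n;
  arc_irrefl : irreflexive arc }.

Section Degrees.
Variables (n : nat) (G : digraph n).

Definition outdeg (i : 'I_n) : nat := #|[set j | G i j]|.
Definition indeg (i : 'I_n) : nat := #|[set j | G j i]|.

Definition num_arcs : nat := #|[set p : 'I_n * 'I_n | G p.1 p.2]|.

Definition max_outdeg : nat := \max_(i < n) outdeg i.
Definition max_indeg : nat := \max_(i < n) indeg i.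
(* Every outdegree is below n, so the default value n is reached only when
   there is no vertex. *)
Definition min_outdeg : nat := \big[minn/n]_(i < n) outdeg i.

Definition strongly_connected : Prop := forall u v : 'I_n, connect G u v.

Definition regular_digraph : Prop :=
  exists k : nat, forall i : 'I_n, outdeg i = k /\ indeg i = k.

End Degrees.

Section Aalpha.
Variables (R : realType) (n : nat).

Definition adjacency (G : digraph n) : 'M[R]_n :=
  \matrix_(i, j) (G i j)%:R.

Definition outdeg_mx (G : digraph n) : 'M[R]_n :=
  diag_mx (\row_i (outdeg G i)%:R).

Definition A_alpha (alpha : R) (G : digraph n) : 'M[R]_n :=
  alpha *: outdeg_mx G + (1 - alpha) *: adjacency G.

Definition complex_mx (M : 'M[R]_n) : 'M[R[i]]_n :=
  map_mx (real_complex R) M.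

Definition eigenvalue_of_largest_modulus (M : 'M[R]_n) (z : R[i]) : Prop :=
  eigenvalue (complex_mx M) z /\
  forall mu : R[i], eigenvalue (complex_mx M) mu -> `|mu| <= `|z|.

(* Several eigenvalues may share the largest modulus (a directed cycle with
   alpha = 0, say); the Perron root is the nonnegative real one.  It is unique
   since it equals its own modulus, and exists by the Perron-Frobenius theorem
   as A_alpha is entrywise nonnegative when 0 <= alpha <= 1 (and n > 0); the default value
   0 of xget is then irrelevant. *)
Definition lambda_alpha (alpha : R) (G : digraph n) : R :=
  xget 0 [set r : R | 0 <= r /\
    eigenvalue_of_largest_modulus (A_alpha alpha G) r%:C]%classic.

End Aalpha.

(* Main.v *)
(** Write [a i j] for the adjacency entries, [d i] for the outdegrees and
    [S := m - delta (n - Delta^-)].  If [mu] is a complex eigenvalue with left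
    eigenvector [v], then [w := |v|] satisfies
    [|mu| w j <= alpha Delta^+ w j + (1 - alpha) y j] with [y := w A].
    Weighting Cauchy-Schwarz by the outdegrees gives
    [y j ^ 2 <= (\sum_i a i j d i) t j], where
    [t j := \sum_i a i j w i ^ 2 / d i] and [\sum_j t j <= \sum_i w i ^ 2].  Since
    [S - \sum_i a i j d i
     = \sum_(i | ~~ G i j) (d i - delta) + delta (Delta^- - d^- j) >= 0],
    we get [|y|^2 <= S |w|^2], whence the bound.  If the bound is attained, all
    these inequalities are equalities; strong connectivity makes [w] positive,
    so [d i = delta] for every non-arc [(i, j)], in particular for [i = j], and
    [d^- j = Delta^-] for all [j].  Conversely, the all-ones vector is an
    eigenvector of a regular digraph whose eigenvalue is the bound. *)
Require Import Defs.
From mathcomp Require Import all_boot all_order all_algebra.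
From mathcomp Require Import reals.
From mathcomp Require Import complex classical_sets ring lra.
Set Implicit Arguments.
Unset Strict Implicit.
Unset Printing Implicit Defensive.
Import Order.TTheory GRing.Theory Num.Theory.
Local Open Scope ring_scope.

(** * Cauchy-Schwarz and moduli of eigenvectors *)

(** Summing [p i * P * (x i / p i - y / P) ^+ 2 >= 0] over [i] gives [t * P - y ^+ 2 >= 0]; where
    [p i = 0] the term vanishes because [x i = 0]. *)
Lemma cauchy_schwarz_div (R : realFieldType) (I : finType) (p x : I -> R) :
    (forall i, 0 <= p i) -> (forall i, p i = 0 -> x i = 0) ->
  (\sum_i x i) ^+ 2 <= (\sum_i p i) * (\sum_i x i ^+ 2 / p i).
Proof.
move=> p_ge0 p0x; set P := \sum_i p i; set y := \sum_i x i; set t := \sum_i _.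
have [P0|P_neq0] := eqVneq P 0.
  have /psumr_eq0P p0 : \sum_i p i = 0 by [].
  by rewrite P0 mul0r /y big1 ?expr0n // => i _; apply/p0x/p0.
have P_gt0 : 0 < P by rewrite lt_def P_neq0 sumr_ge0.
have : 0 <= \sum_i (x i ^+ 2 / p i * P - 2 * y * x i + y ^+ 2 * (p i / P)).
  apply: sumr_ge0 => i _.
  have [pi0|pi_neq0] := eqVneq (p i) 0.
    by rewrite pi0 p0x // expr0n !mul0r !mulr0 subr0 addr0.
  have -> : x i ^+ 2 / p i * P - 2 * y * x i + y ^+ 2 * (p i / P)
            = p i * P * (x i / p i - y / P) ^+ 2.
    by field; rewrite pi_neq0 P_neq0.
  by rewrite mulr_ge0 ?sqr_ge0 // mulr_ge0 // ltW.
rewrite big_split sumrB /= -!mulr_suml -!mulr_sumr -mulr_suml divff // -/y -/t.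
by move=> ?; nra.
Qed.

(** Take for [w] the entrywise modulus of a left eigenvector and apply the triangle inequality in
    each column; [complex.Re] only brings the modulus back into [R]. *)
Lemma eigenvalue_modulus_subinvariant (R : realType) (n : nat) (M : 'M[R]_n)
    (mu : R[i]) :
    (forall i j, 0 <= M i j) -> eigenvalue (complex_mx M) mu ->
  exists w : 'I_n -> R,
    [/\ forall i, 0 <= w i, exists i, w i != 0
      & forall j, complex.Re `|mu| * w j <= \sum_i w i * M i j].
Proof.
move=> M_ge0 /eigenvalueP [v vM v_neq0].
have absE (z : R[i]) : (complex.Re `|z|)%:C%C = `|z|.
  by rewrite RRe_real ?normr_real.
exists (fun i => complex.Re `|v 0 i|); split.
- by move=> i; rewrite -ler0c absE.
- have [i vi_neq0] := rV0Pn v v_neq0; exists i.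
  apply: contraNneq vi_neq0 => vi0.
  by rewrite -normr_eq0 -absE vi0.
- move=> j; rewrite -lecR rmorphM /= !absE -normrM.
  have -> : mu * v 0 j = \sum_i v 0 i * (M i j)%:C%C.
    have := congr1 (fun u : 'rV_n => u 0 j) vM.
    by rewrite !mxE => <-; apply: eq_bigr => i _; rewrite mxE.
  rewrite rmorph_sum /=; apply: le_trans (ler_norm_sum _ _ _) _.
  apply: ler_sum => i _; rewrite normrM rmorphM /= absE.
  by rewrite (@ger0_norm _ (M i j)%:C%C) // ler0c.
Qed.

(** * Degrees and arc counts *)

Lemma outdeg_sum (R : realType) (n : nat) (G : digraph n) (i : 'I_n) :
  (outdeg G i)%:R = \sum_j adjacency R G i j.
Proof.
rewrite /outdeg -sum1dep_card natr_sum big_mkcond.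
by apply: eq_bigr => j _; rewrite mxE; case: (G i j).
Qed.

Lemma indeg_sum (R : realType) (n : nat) (G : digraph n) (j : 'I_n) :
  (indeg G j)%:R = \sum_i adjacency R G i j.
Proof.
rewrite /indeg -sum1dep_card natr_sum big_mkcond.
by apply: eq_bigr => i _; rewrite mxE; case: (G i j).
Qed.

Lemma num_arcs_outdeg (n : nat) (G : digraph n) :
  num_arcs G = (\sum_i outdeg G i)%N.
Proof.
rewrite /num_arcs -sum1dep_card.
under [RHS]eq_bigr do rewrite /outdeg -sum1dep_card.
by rewrite pair_big_dep.
Qed.

Lemma num_arcs_indeg (n : nat) (G : digraph n) :
  num_arcs G = (\sum_i indeg G i)%N.
Proof.
rewrite num_arcs_outdeg.
under eq_bigr do rewrite /outdeg -sum1dep_card.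
rewrite (exchange_big_dep predT) //=.
by under eq_bigr do rewrite sum1dep_card.
Qed.

Lemma min_outdeg_le (n : nat) (G : digraph n) (i : 'I_n) :
  (min_outdeg G <= outdeg G i)%N.
Proof.
rewrite /min_outdeg; have: i \in index_enum 'I_n by rewrite mem_index_enum.
elim: (index_enum _) => // k r IHr; rewrite big_cons inE geq_min.
by case/predU1P => [->|/IHr ->]; rewrite ?leqnn ?orbT.
Qed.

(** The hypothesis [0 < n] makes the default value of the big minimum positive. *)
Lemma min_outdeg_gt0 (n : nat) (G : digraph n) :
  (0 < n)%N -> (forall i, 0 < outdeg G i)%N -> (0 < min_outdeg G)%N.
Proof.
move=> n_gt0 d_gt0; apply: (big_ind (fun k => 0 < k)%N) => // x y x0 y0.
by rewrite leq_min x0.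
Qed.

Lemma indeg_le_max (n : nat) (G : digraph n) (i : 'I_n) :
  (indeg G i <= max_indeg G)%N.
Proof. exact: leq_bigmax. Qed.

Lemma outdeg_le_max (n : nat) (G : digraph n) (i : 'I_n) :
  (outdeg G i <= max_outdeg G)%N.
Proof. exact: leq_bigmax. Qed.

(** A path from [i] to some other vertex begins with an arc leaving [i]. *)
Lemma strongly_connected_outdeg_gt0 (n : nat) (G : digraph n) (i : 'I_n) :
  (1 < n)%N -> strongly_connected G -> (0 < outdeg G i)%N.
Proof.
move=> n_gt1 G_sc.
have [j ji] : exists j : 'I_n, j != i.
  apply/existsP; rewrite -negb_forall; apply/negP => /forallP all_i.
  suff : #|'I_n| = 1%N by rewrite card_ord => n1; rewrite n1 in n_gt1.
  by rewrite -(card1 i); apply: eq_card => k; rewrite !inE (eqP (all_i k)) eqxx.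
case/connectP: (G_sc i j) => [[|k s] /=].
  by move=> _ ij; rewrite ij eqxx in ji.
by move=> /andP[Gik _] _; apply/card_gt0P; exists k; rewrite inE.
Qed.

(** * The radicand and outdegree sums over in-neighbours *)

Definition degree_radicand (R : realType) (n : nat) (G : digraph n) : R :=
  (num_arcs G)%:R - (min_outdeg G)%:R * (n%:R - (max_indeg G)%:R).

Lemma degree_radicand_ge (R : realType) (n : nat) (G : digraph n) :
  (min_outdeg G)%:R * (max_indeg G)%:R <= degree_radicand R G.
Proof.
suff : ((min_outdeg G)%:R * n%:R : R) <= (num_arcs G)%:R.
  by rewrite /degree_radicand => ?; lra.
rewrite -natrM ler_nat num_arcs_outdeg mulnC -{1}(card_ord n) -sum_nat_const.
by apply: leq_sum => i _; apply: min_outdeg_le.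
Qed.

Lemma degree_radicand_ge0 (R : realType) (n : nat) (G : digraph n) :
  0 <= degree_radicand R G.
Proof. by apply: le_trans (degree_radicand_ge R G); rewrite mulr_ge0 ?ler0n. Qed.

(** With [m] written as the sum of the outdegrees and the indegree of [j] as a column sum, the
    difference regroups into terms of visible sign. *)
Lemma degree_radicand_sub (R : realType) (n : nat) (G : digraph n) (j : 'I_n) :
  degree_radicand R G - \sum_i adjacency R G i j * (outdeg G i)%:R
  = \sum_i (1 - adjacency R G i j) * ((outdeg G i)%:R - (min_outdeg G)%:R)
    + (min_outdeg G)%:R * ((max_indeg G)%:R - (indeg G j)%:R).
Proof.
under [in RHS]eq_bigr do rewrite mulrBl mul1r mulrBr.
rewrite !sumrB -mulr_suml -indeg_sum /degree_radicand num_arcs_outdeg natr_sum.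
rewrite sumr_const card_ord -mulr_natr.
by ring.
Qed.

Lemma in_nbr_outdeg_sum_le (R : realType) (n : nat) (G : digraph n) (j : 'I_n) :
  \sum_i adjacency R G i j * (outdeg G i)%:R <= degree_radicand R G.
Proof.
rewrite -subr_ge0 degree_radicand_sub addr_ge0 //.
  apply: sumr_ge0 => i _; rewrite mulr_ge0 // subr_ge0.
    by rewrite mxE; case: (G i j).
  by rewrite ler_nat min_outdeg_le.
by rewrite mulr_ge0 // subr_ge0 ler_nat indeg_le_max.
Qed.

Lemma regular_of_in_nbr_outdeg_sum (R : realType) (n : nat) (G : digraph n) :
    (0 < n)%N -> (0 < min_outdeg G)%N ->
    (forall j, \sum_i adjacency R G i j * (outdeg G i)%:R
               = degree_radicand R G) ->
  regular_digraph G.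
Proof.
move=> n_gt0 delta_gt0 sumE.
have dE j : outdeg G j = min_outdeg G /\ indeg G j = max_indeg G.
  have := degree_radicand_sub R G j; rewrite sumE subrr => /esym /eqP.
  have ge0 i : 0 <= (1 - adjacency R G i j) * ((outdeg G i)%:R - (min_outdeg G)%:R).
    rewrite mulr_ge0 // subr_ge0; first by rewrite mxE; case: (G i j).
    by rewrite ler_nat min_outdeg_le.
  rewrite paddr_eq0 ?sumr_ge0 //; last first.
    by rewrite mulr_ge0 // subr_ge0 ler_nat indeg_le_max.
  case/andP => /eqP /psumr_eq0P out0 in0; split.
    (* There are no loops, so the term [i = j] has factor 1 and forces the outdegree of [j] to be
       minimal. *)
    have := out0 (fun i _ => ge0 i) j isT.
    rewrite mxE arc_irrefl subr0 mul1r => /eqP.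
    by rewrite subr_eq0 eqr_nat => /eqP.
  move: in0; rewrite mulf_eq0 pnatr_eq0 eqn0Ngt delta_gt0 /=.
  by rewrite subr_eq0 eqr_nat => /eqP.
exists (min_outdeg G) => i; have [-> ->] := dE i; split => //.
(* Counting the arcs by heads and by tails identifies the two constant degrees. *)
have : (\sum_i indeg G i = \sum_i outdeg G i)%N.
  by rewrite -num_arcs_indeg num_arcs_outdeg.
under eq_bigr do rewrite (dE _).2.
under [in RHS]eq_bigr do rewrite (dE _).1.
rewrite !sum_nat_const card_ord => /eqP.
by rewrite eqn_pmul2l // => /eqP.
Qed.

(** * Subinvariant vectors of the adjacency matrix *)

Lemma adjacency_ge0 (R : realType) (n : nat) (G : digraph n) (i j : 'I_n) :
  0 <= adjacency R G i j.
Proof. by rewrite mxE. Qed.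

(** Cauchy-Schwarz with weights [a i j * d i]; since [a i j] is 0 or 1, its square cancels to
    [a i j] in the quotients. *)
Lemma sqr_adjacency_mul_le (R : realType) (n : nat) (G : digraph n)
    (w : 'I_n -> R) (j : 'I_n) :
  (\sum_i w i * adjacency R G i j) ^+ 2
  <= (\sum_i adjacency R G i j * (outdeg G i)%:R)
     * (\sum_i w i ^+ 2 * (adjacency R G i j / (outdeg G i)%:R)).
Proof.
apply: le_trans (@cauchy_schwarz_div R _
  (fun i => adjacency R G i j * (outdeg G i)%:R) _ _ _) _.
- by move=> i; rewrite mulr_ge0 ?adjacency_ge0.
(* A weight vanishes only off the arcs into [j]: the tail of an arc has positive outdegree. *)
- move=> i; rewrite mxE; case Gij: (G i j); last by rewrite mulr0.
  rewrite mul1r => /eqP; rewrite pnatr_eq0 cards_eq0 => /eqP/setP/(_ j).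
  by rewrite !inE Gij.
- rewrite ler_wpM2l //; first by apply: sumr_ge0 => i _; rewrite mulr_ge0 ?adjacency_ge0.
  apply: ler_sum => i _; rewrite mxE; case: (G i j).
    by rewrite mulr1 !mul1r.
  by rewrite mulr0 expr0n !mul0r mulr0.
Qed.

(** After exchanging the sums, [w i ^+ 2] has coefficient [d i / d i], which is 1, or 0 when
    [d i = 0]. *)
Lemma sum_weighted_sqr_le (R : realType) (n : nat) (G : digraph n)
    (w : 'I_n -> R) :
  \sum_j \sum_i w i ^+ 2 * (adjacency R G i j / (outdeg G i)%:R)
  <= \sum_i w i ^+ 2.
Proof.
rewrite exchange_big; apply: ler_sum => i _ /=.
rewrite -mulr_sumr -mulr_suml -outdeg_sum ler_piMr ?sqr_ge0 //.
have [->|d_neq0] := eqVneq ((outdeg G i)%:R : R) 0; first by rewrite mul0r.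
by rewrite divff.
Qed.

(** If [c] exceeded the root it would be positive, so the inequalities could be squared and summed
    to give [c ^+ 2 <= S]. *)
Lemma adjacency_subinvariant_le (R : realType) (n : nat) (G : digraph n)
    (w : 'I_n -> R) (c : R) :
    (forall i, 0 <= w i) -> (exists i, w i != 0) ->
    (forall j, c * w j <= \sum_i w i * adjacency R G i j) ->
  c <= Num.sqrt (degree_radicand R G).
Proof.
move=> w_ge0 [k wk] cw; rewrite leNgt; apply/negP => c_gt.
have c_gt0 : 0 < c by apply: le_lt_trans c_gt; rewrite sqrtr_ge0.
have W_gt0 : 0 < \sum_i w i ^+ 2.
  rewrite (bigD1 k) //= ltr_pwDl ?exprn_even_gt0 //.
  by apply: sumr_ge0 => i _; rewrite sqr_ge0.
have S_lt : degree_radicand R G < c ^+ 2.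
  by rewrite -(sqr_sqrtr (degree_radicand_ge0 R G)) ltrXn2r // ?nnegrE ?sqrtr_ge0 ?ltW.
have : c ^+ 2 * \sum_i w i ^+ 2 <= degree_radicand R G * \sum_i w i ^+ 2.
  apply: le_trans (ler_wpM2l (degree_radicand_ge0 R G) (sum_weighted_sqr_le G w)).
  rewrite !mulr_sumr; apply: ler_sum => j _; rewrite -exprMn.
  apply: (@le_trans _ _ ((\sum_i w i * adjacency R G i j) ^+ 2)).
    by rewrite lerXn2r ?nnegrE ?mulr_ge0 ?(ltW c_gt0) // (le_trans _ (cw j)) // mulr_ge0 // ltW.
  apply: le_trans (sqr_adjacency_mul_le G w j) _.
  rewrite ler_wpM2r ?in_nbr_outdeg_sum_le //.
  by apply: sumr_ge0 => i _; rewrite mulr_ge0 ?sqr_ge0 ?divr_ge0 ?adjacency_ge0.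
by rewrite ler_pM2r // leNgt S_lt.
Qed.

Lemma adjacency_subinvariant_eq (R : realType) (n : nat) (G : digraph n)
    (w : 'I_n -> R) :
    strongly_connected G -> 0 < degree_radicand R G ->
    (forall i, 0 <= w i) -> (exists i, w i != 0) ->
    (forall j, Num.sqrt (degree_radicand R G) * w j
               <= \sum_i w i * adjacency R G i j) ->
  forall j, \sum_i adjacency R G i j * (outdeg G i)%:R = degree_radicand R G.
Proof.
set S := degree_radicand R G => G_sc S_gt0 w_ge0 [k wk] cw.
pose y j := \sum_i w i * adjacency R G i j.
pose s j := \sum_i adjacency R G i j * (outdeg G i)%:R.
pose t j := \sum_i w i ^+ 2 * (adjacency R G i j / (outdeg G i)%:R).
have t_ge0 j : 0 <= t j.
  by apply: sumr_ge0 => i _; rewrite mulr_ge0 ?sqr_ge0 ?divr_ge0 ?adjacency_ge0.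
have Sw_le j : S * w j ^+ 2 <= y j ^+ 2.
  rewrite -{1}(sqr_sqrtr (ltW S_gt0)) -exprMn.
  by rewrite lerXn2r ?nnegrE ?mulr_ge0 ?sqrtr_ge0 // (le_trans _ (cw j)) // mulr_ge0 ?sqrtr_ge0.
have y_le j : y j ^+ 2 <= s j * t j by exact: sqr_adjacency_mul_le.
have st_le j : s j * t j <= S * t j by rewrite ler_wpM2r ?in_nbr_outdeg_sum_le.
(* The differences are nonnegative and their sum is at most 0, so each is 0. *)
have StE j : S * t j = S * w j ^+ 2.
  apply/eqP; rewrite -subr_eq0.
  have ge0 i : 0 <= S * t i - S * w i ^+ 2.
    by rewrite subr_ge0 (le_trans (Sw_le i)) // (le_trans (y_le i)).
  have : \sum_i (S * t i - S * w i ^+ 2) = 0.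
    apply/eqP; rewrite eq_le sumr_ge0 // andbT sumrB -!mulr_sumr -mulrBr.
    by rewrite pmulr_rle0 // subr_le0 sum_weighted_sqr_le.
  by move=> /psumr_eq0P -/(_ (fun i _ => ge0 i)) ->.
(* Zeros of [w] spread backwards along arcs: [w j = 0] forces [y j = 0], a sum of nonnegative
   terms. *)
have w_arc i j : G i j -> w j = 0 -> w i = 0.
  move=> Gij wj0.
  have yj0 : y j = 0.
    apply/eqP; rewrite -sqrf_eq0 eq_le sqr_ge0 andbT.
    by rewrite (le_trans (y_le j)) // (le_trans (st_le j)) // StE wj0 expr0n mulr0.
  have := psumr_eq0P (fun i _ => mulr_ge0 (w_ge0 i) (adjacency_ge0 R G i j)) yj0.
  by move=> /(_ i isT); rewrite mxE Gij mulr1.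
have w_path i j : connect G i j -> w j = 0 -> w i = 0.
  case/connectP => p; elim: p i => [|l p IHp] i /=; first by move=> _ ->.
  by case/andP => Gil pl jE wj0; apply: (w_arc _ _ Gil); apply: IHp.
move=> j.
(* A zero at [j] would spread to [k], where [w] is nonzero. *)
have wj : w j != 0 by apply: contraNneq wk => /(w_path k j (G_sc k j)) ->.
have t_gt0 : 0 < t j.
  by rewrite -(pmulr_rgt0 _ S_gt0) StE mulr_gt0 // exprn_even_gt0.
apply: (mulIf (lt0r_neq0 t_gt0)); apply/eqP; rewrite eq_le st_le.
by rewrite StE (le_trans (Sw_le j)).
Qed.

(** * From the adjacency matrix to [A_alpha] *)

Lemma A_alpha_ge0 (R : realType) (alpha : R) (n : nat) (G : digraph n) i j :
  0 <= alpha -> alpha < 1 -> 0 <= A_alpha alpha G i j.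
Proof.
move=> a_ge0 a_lt1; rewrite !mxE addr_ge0 // mulr_ge0 ?subr_ge0 ?(ltW a_lt1) //.
by rewrite mulrn_wge0.
Qed.

Lemma mul_A_alpha (R : realType) (alpha : R) (n : nat) (G : digraph n)
    (w : 'I_n -> R) (j : 'I_n) :
  \sum_i w i * A_alpha alpha G i j
  = alpha * (outdeg G j)%:R * w j
    + (1 - alpha) * \sum_i w i * adjacency R G i j.
Proof.
have -> : alpha * (outdeg G j)%:R * w j
          = \sum_i w i * (alpha * outdeg_mx R G i j).
  rewrite (bigD1 j) //= big1 ?addr0; first by rewrite !mxE eqxx mulr1n mulrC.
  by move=> i ij; rewrite !mxE (negbTE ij) mulr0n !mulr0.
rewrite mulr_sumr -big_split; apply: eq_bigr => i _ /=.
rewrite [A_alpha _ _ _ _]mxE [(_ *: outdeg_mx _ _) _ _]mxE.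
by rewrite [(_ *: adjacency _ _) _ _]mxE; ring.
Qed.

Definition A_alpha_bound (R : realType) (alpha : R) (n : nat) (G : digraph n) : R :=
  alpha * (max_outdeg G)%:R + (1 - alpha) * Num.sqrt (degree_radicand R G).

Lemma A_alpha_bound_ge0 (R : realType) (alpha : R) (n : nat) (G : digraph n) :
  0 <= alpha -> alpha < 1 -> 0 <= A_alpha_bound alpha G.
Proof.
by move=> a_ge0 a_lt1; rewrite addr_ge0 ?mulr_ge0 ?sqrtr_ge0 // subr_ge0 ltW.
Qed.

(** Bounding the diagonal part by the maximum outdegree and dividing by [1 - alpha > 0] leaves an
    inequality for the adjacency matrix alone. *)
Lemma A_alpha_eigenvalue_subinvariant (R : realType) (alpha : R) (n : nat)
    (G : digraph n) (mu : R[i]) :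
    0 <= alpha -> alpha < 1 -> eigenvalue (complex_mx (A_alpha alpha G)) mu ->
  exists w : 'I_n -> R,
    [/\ forall i, 0 <= w i, exists i, w i != 0
      & forall j,
          (complex.Re `|mu| - alpha * (max_outdeg G)%:R) / (1 - alpha) * w j
          <= \sum_i w i * adjacency R G i j].
Proof.
move=> a_ge0 a_lt1 /eigenvalue_modulus_subinvariant [i j|w [w_ge0 w_neq0 muw]].
  exact: A_alpha_ge0.
exists w; split => // j.
rewrite mulrAC ler_pdivrMr ?subr_gt0 // mulrBl lerBlDl.
apply: le_trans (muw j) _; rewrite mul_A_alpha [X in _ <= _ + X]mulrC lerD2r.
by rewrite ler_wpM2r // ler_wpM2l // ler_nat outdeg_le_max.
Qed.

Lemma A_alpha_eigenvalue_le (R : realType) (alpha : R) (n : nat) (G : digraph n)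
    (mu : R[i]) :
    0 <= alpha -> alpha < 1 -> eigenvalue (complex_mx (A_alpha alpha G)) mu ->
  complex.Re `|mu| <= A_alpha_bound alpha G.
Proof.
move=> a_ge0 a_lt1 /(A_alpha_eigenvalue_subinvariant a_ge0 a_lt1).
case=> w [w_ge0 w_neq0 cw].
have := @adjacency_subinvariant_le R n G w _ w_ge0 w_neq0 cw.
by rewrite ler_pdivrMr ?subr_gt0 // lerBlDl [_ * (1 - _)]mulrC.
Qed.

Lemma Re_norm_real (R : realType) (r : R) : 0 <= r -> complex.Re `|r%:C%C| = r.
Proof. by move=> r_ge0; rewrite ger0_norm ?ler0c. Qed.

Lemma A_alpha_bound_gt0 (R : realType) (alpha : R) (n : nat) (G : digraph n) :
    (1 < n)%N -> strongly_connected G -> 0 <= alpha -> alpha < 1 ->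
  0 < degree_radicand R G /\ 0 < A_alpha_bound alpha G.
Proof.
move=> n_gt1 G_sc a_ge0 a_lt1.
have d_gt0 i : (0 < outdeg G i)%N by exact: strongly_connected_outdeg_gt0.
have delta_gt0 := min_outdeg_gt0 (ltnW n_gt1) d_gt0.
have Delta_gt0 : (0 < max_indeg G)%N.
  have := d_gt0 (Ordinal n_gt1); case/card_gt0P => j; rewrite inE => Gij.
  apply: leq_trans (indeg_le_max G j).
  by apply/card_gt0P; exists (Ordinal n_gt1); rewrite inE.
have S_gt0 : 0 < degree_radicand R G.
  by apply: lt_le_trans (degree_radicand_ge R G); rewrite mulr_gt0 ?ltr0n.
by rewrite S_gt0 ltr_wpDl ?mulr_ge0 // mulr_gt0 ?subr_gt0 // sqrtr_gt0.
Qed.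

(** * Regular digraphs *)

Lemma A_alpha_bound_regular (R : realType) (alpha : R) (n k : nat)
    (G : digraph n) :
    (0 < n)%N -> (forall i, outdeg G i = k /\ indeg G i = k) ->
  A_alpha_bound alpha G = k%:R.
Proof.
move=> n_gt0 dk; pose i0 := Ordinal n_gt0.
have DoutE : max_outdeg G = k.
  apply/eqP; rewrite eqn_leq -{2}(dk i0).1 outdeg_le_max andbT.
  by apply/bigmax_leqP => i _; rewrite (dk i).1.
have DinE : max_indeg G = k.
  apply/eqP; rewrite eqn_leq -{2}(dk i0).2 indeg_le_max andbT.
  by apply/bigmax_leqP => i _; rewrite (dk i).2.
have deltaE : min_outdeg G = k.
  apply/eqP; rewrite eqn_leq -{1}(dk i0).1 min_outdeg_le /=.
  apply: (big_ind (fun x => k <= x)%N) => [|x y kx ky|i _].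
  (* The default value [n] of the minimum is at least [k], a number of vertices. *)
  - by rewrite -(dk i0).1 -[X in (_ <= X)%N]card_ord max_card.
  - by rewrite leq_min kx.
  - by rewrite (dk i).1.
have mE : num_arcs G = (n * k)%N.
  rewrite num_arcs_outdeg; under eq_bigr do rewrite (dk _).1.
  by rewrite sum_nat_const card_ord.
rewrite /A_alpha_bound /degree_radicand DoutE DinE deltaE mE natrM.
have -> : n%:R * k%:R - k%:R * (n%:R - k%:R) = k%:R ^+ 2 :> R by ring.
by rewrite sqrtr_sqr ger0_norm //; ring.
Qed.

(** For the all-ones row vector, column [j] sums to [alpha] times its outdegree plus [1 - alpha]
    times its indegree. *)
Lemma A_alpha_regular_eigenvalue (R : realType) (alpha : R) (n k : nat)
    (G : digraph n) :
    (0 < n)%N -> (forall i, outdeg G i = k /\ indeg G i = k) ->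
  eigenvalue (complex_mx (A_alpha alpha G)) (k%:R : R)%:C%C.
Proof.
move=> n_gt0 dk; apply/eigenvalueP; exists (const_mx 1); last first.
  by apply/rV0Pn; exists (Ordinal n_gt0); rewrite mxE oner_neq0.
apply/rowP => j; rewrite !mxE mulr1.
under eq_bigr do rewrite [const_mx _ _ _]mxE mul1r [complex_mx _ _ _]mxE.
rewrite -rmorph_sum /=; congr (_%:C)%C.
have := mul_A_alpha alpha G (fun=> 1) j => /=.
under eq_bigr do rewrite mul1r; move=> ->.
under eq_bigr do rewrite mul1r.
by rewrite -indeg_sum (dk j).1 (dk j).2; ring.
Qed.

(** The eigenvalue [k] equals the bound, hence has largest modulus; any other candidate is at most
    [k] by the bound and at least [k] by maximality. *)
Lemma lambda_alpha_regular (R : realType) (alpha : R) (n : nat) (G : digraph n) :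
    0 <= alpha -> alpha < 1 -> (0 < n)%N -> regular_digraph G ->
  lambda_alpha alpha G = A_alpha_bound alpha G.
Proof.
move=> a_ge0 a_lt1 n_gt0 [k dk]; rewrite (@A_alpha_bound_regular _ _ _ k) //.
have eig_k := A_alpha_regular_eigenvalue alpha n_gt0 dk.
apply: xget_unique => [|r [r_ge0 [eig_r r_max]]].
  split => //; split => // mu eig_mu.
  rewrite -[`|mu|]RRe_real ?normr_real // [leRHS]ger0_norm ?ler0c // lecR.
  by rewrite -(A_alpha_bound_regular alpha n_gt0 dk) A_alpha_eigenvalue_le.
apply/eqP; rewrite eq_le.
have := A_alpha_eigenvalue_le a_ge0 a_lt1 eig_r.
rewrite Re_norm_real // (A_alpha_bound_regular alpha n_gt0 dk) => -> /=.
by have := r_max _ eig_k; rewrite !ger0_norm ?ler0c // lecR.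
Qed.

Theorem theorem2p3 (R : realType) (alpha : R) (n : nat) (G : digraph n)
    (alpha_ge0 : 0 <= alpha) (alpha_lt1 : alpha < 1)
    (n_gt0 : (0 < n)%N) (G_sc : strongly_connected G) :
  let bound : R :=
    alpha * (max_outdeg G)%:R
    + (1 - alpha) * Num.sqrt ((num_arcs G)%:R
        - (min_outdeg G)%:R * (n%:R - (max_indeg G)%:R)) in
  lambda_alpha alpha G <= bound /\
  (lambda_alpha alpha G = bound <-> regular_digraph G).
Proof.
move=> bound; rewrite -[bound]/(A_alpha_bound alpha G).
split; [|split; last exact: lambda_alpha_regular].
  rewrite /lambda_alpha; case: xgetP => [r _ [r_ge0 [eig_r _]]|_].
    by have := A_alpha_eigenvalue_le alpha_ge0 alpha_lt1 eig_r; rewrite Re_norm_real.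
  (* Here [xget] returns its default value 0. *)
  exact: A_alpha_bound_ge0.
(* A single vertex carries no arc, so the digraph is regular of degree 0. *)
have [n_gt1|n_le1] := ltnP 1 n; last first.
  move=> _; exists 0%N => i.
  have arc0 a b : G a b = false.
    have val0 (c : 'I_n) : val c = 0%N.
      by apply/eqP; rewrite -leqn0 -ltnS (leq_trans (ltn_ord c)).
    by have -> : a = b; [apply: val_inj; rewrite !val0 | rewrite arc_irrefl].
  by split; apply/eqP; rewrite cards_eq0; apply/eqP/setP => j; rewrite !inE arc0.
have [S_gt0 bound_gt0] := A_alpha_bound_gt0 n_gt1 G_sc alpha_ge0 alpha_lt1.
rewrite /lambda_alpha; case: xgetP => [r _ [r_ge0 [eig_r _]] rE|_ bound0].
  have [w [w_ge0 w_neq0]] :=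
    A_alpha_eigenvalue_subinvariant alpha_ge0 alpha_lt1 eig_r.
  (* With [r] equal to the bound, the constant of subinvariance becomes exactly the square root of
     the radicand. *)
  rewrite Re_norm_real // rE /A_alpha_bound addrAC subrr add0r mulrC mulKf; last first.
    by rewrite subr_eq0 eq_sym lt_eqF.
  move=> cw; apply: (@regular_of_in_nbr_outdeg_sum R) => //.
    by apply: min_outdeg_gt0 => // i; apply: strongly_connected_outdeg_gt0.
  exact: (@adjacency_subinvariant_eq R n G w).
(* The default value 0 cannot equal the positive bound. *)
by rewrite -bound0 ltxx in bound_gt0.
Qed.
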